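(* Let $S = A_5$, the alternating group on $\{1,\ldots,5\}$. Then the following hold. (a) $\sigma(S) = 1/3$, and for $s \in S^\times$ one has $\sigma(S,s) = 1/3$ exactly when $s$ has order $5$. (b) For $s \in S$ of order $5$, $\mathcal{M}(S,s)$ consists of one group, which is dihedral of order $10$. (c) $P(S) = 1/3$, and for $s \in S^\times$ one has $P(S,s) = 1/3$ exactly when $s$ has order $5$. (d) For each $g \in S$, at least one of the elements $x \in \{(1,2)(3,4),\ (1,3)(2,4),\ (1,4)(2,3)\}$ has the property that $\langle g, x\rangle$ is a proper subgroup of $S$. (e) Both the spread and the uniform spread of $S$ are exactly two, where for the uniform spread the class can be taken to consist of elements $s$ of order $5$.
   Context: For a finite nonabelian simple group $S$ let $S^\times = S \setminus \{1\}$. For $s \in S^\times$, $\mathcal{M}(S,s)$ is the set of all maximal subgroups of $S$ containing $s$. For $M \le S$, $1_M^S$ is the permutation character of $S$ on the right cosets of $M$. For $g \in S^\times$ set $\sigma(g,s) = \sum_{M \in \mathcal{M}(S,s)} 1_M^S(g)/1_M^S(1)$, $\sigma(S,s) = \max\{\sigma(g,s) : g \in S^\times\}$, $\sigma(S) = \min\{\sigma(S,s) : s \in S^\times\}$. Further $P(g,s) = |\{h \in S : \langle s^h, g\rangle \neq S\}|/|S|$, $P(S,s) = \max\{P(g,s) : g \in S^\times\}$, $P(S) = \min\{P(S,s) : s \in S^\times\}$. $S$ has spread at least $k$ if for any $g_1,\ldots,g_k \in S^\times$ there is $s \in S$ with $\langle g_i, s\rangle = S$ for $1 \le i \le k$;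 it has uniform spread at least $k$ if there is a fixed conjugacy class $C$ of $S$ such that $s$ can always be chosen in $C$. The (uniform) spread is exactly $k$ if it is at least $k$ but not at least $k+1$. *)

(* Defs.v *)
From mathcomp Require Import all_boot all_order all_algebra.
From mathcomp Require Import all_fingroup all_solvable.

Set Implicit Arguments.
Unset Strict Implicit.
Unset Printing Implicit Defensive.

Local Open Scope group_scope.

Section Generation.

Variables (gT : finGroupType) (S : {group gT}).
Implicit Types (M : {group gT}) (g s : gT).

(* The library's [maximal] only allows proper subgroups. *)
Definition max_subgroups s : {set {group gT}} :=
  [set M : {group gT} | maximal M S & s \in M].

(* The value at g of the permutation character 1_M^S: the number of right
   cosets of M in S fixed by right multiplication by g. *)
Definition perm_char M g : nat := #|'Fix_(rcosets M S | 'Rs)[g]|.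

(* Extrema over the nonidentity elements of S.  The starting value of the
   iteration is the value of f at some element of S^#, as soon as S is
   nontrivial; hence it does not affect the result. *)
Definition max_nonid (f : gT -> rat) : rat :=
  \big[Order.max/f (repr S^#)]_(g in S^#) f g.

Definition min_nonid (f : gT -> rat) : rat :=
  \big[Order.min/f (repr S^#)]_(g in S^#) f g.

Definition sigma_elt g s : rat :=
  (\sum_(M in max_subgroups s) (perm_char M g)%:R / (perm_char M 1%g)%:R)%R.

Definition sigma_class s : rat := max_nonid (fun g => sigma_elt g s).

Definition sigma : rat := min_nonid sigma_class.

Definition P_elt g s : rat :=
  (#|[set h in S | <<[set s ^ h; g]>> != S]%g|%:R / #|S|%:R)%R.

Definition P_class s : rat := max_nonid (fun g => P_elt g s).

Definition P_group : rat := min_nonid P_class.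

(* The g i need not be distinct. *)
Definition spread_ge_in (C : {set gT}) (k : nat) : Prop :=
  forall g : 'I_k -> gT, (forall i, g i \in S^#) ->
  exists2 s, s \in C & forall i, <<[set g i; s]>> = S.

Definition spread_ge (k : nat) : Prop := spread_ge_in S k.

Definition uniform_spread_ge (k : nat) : Prop :=
  exists2 C, C \in classes S & spread_ge_in C k.

Definition spread_is (k : nat) : Prop := spread_ge k /\ ~ spread_ge k.+1.

Definition uniform_spread_is (k : nat) : Prop :=
  uniform_spread_ge k /\ ~ uniform_spread_ge k.+1.

End Generation.

Definition A5 : {group {perm 'I_5}} := 'Alt_('I_5)%G.

(* The points 1, ..., 5 as the ordinals 0, ..., 4. *)
Definition pt (k : nat) : 'I_5 := inord k.-1.

(* The permutation (a,b)(c,d). *)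
Definition dtransp (a b c d : nat) : {perm 'I_5} :=
  tperm (pt a) (pt b) * tperm (pt c) (pt d).

(* Main.v *)
(** For M maximal in S, 1_M^S(g)/1_M^S(1) is the proportion of x in S with
    g in M^x.  It bounds both sigma(g,s) and P(g,s) from below as soon as s lies
    in M, and equals both when M is the only maximal subgroup containing s.

    An element s of order 5 of A5 lies in a unique maximal subgroup, namely
    N(<s>): a subgroup containing s has 1 or 6 Sylow 5-subgroups, and with 6 its
    order is divisible by 30, which simplicity excludes for a proper subgroup.
    The proportion for N(<s>) is at most 1/3, with equality for involutions.  An
    element of A5 whose order is not 5 fixes a point; the point stabilizer is
    maximal, and the proportion is 2/5 when g is a 3-cycle.

    Spread at least 2 follows from 1/3 + 1/3 < 1, and (d) shows that the three
    double transpositions fixing the point 5 have no common mate.  For (d), when g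
    moves the point 5 and is not an involution, one of them inverts g. *)

Require Import Defs.
From mathcomp Require Import all_boot all_order all_algebra.
From mathcomp Require Import all_fingroup all_solvable.

Import Order.TTheory GRing.Theory Num.Theory.

Set Implicit Arguments.
Unset Strict Implicit.
Unset Printing Implicit Defensive.

Local Open Scope group_scope.

(** * Transporters, and how they control both invariants *)

Section Transporters.

Variables (gT : finGroupType) (S : {group gT}).
Implicit Types (M : {group gT}) (g s : gT).

Definition conj_transporter g M : {set gT} := [set x in S | g \in M :^ x].

(** The condition [g \in M :^ x] depends only on the coset [M :* x] and says that [g] fixes it. The
    transporter is thus the disjoint union of the fixed cosets, each of size [#|M|]. *)
Lemma card_conj_transporter M g :
  M \subset S -> g \in S -> #|conj_transporter g M| = (perm_char S M g * #|M|)%N.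
Proof.
move=> sMS Sg; rewrite /perm_char; set F := 'Fix_(_ | _)[g].
have partS := rcosets_partition sMS.
have sF : F \subset rcosets M S by apply: subsetIl.
have fixE x : (M :* x \in F) = (M :* x \in rcosets M S) && (g \in M :^ x).
  rewrite inE; congr (_ && _); rewrite (sameP afix1P eqP) /= rcosetE mem_conjg conjgE invgK.
  by rewrite -rcosetM (sameP eqP rcoset_eqP) mem_rcoset mulgA.
apply: card_uniform_partition => [C /(subsetP sF)/rcosetsP[x _ ->]|].
  exact: card_rcoset.
apply/and3P; split.
- apply/eqP/setP=> x; apply/bigcupP/idP => [[C FC Cx]|].
    have /rcosetsP[y Sy defC] := subsetP sF _ FC.
    have defC' : C = M :* x by rewrite defC; apply/esym/rcoset_eqP; rewrite -defC.
    move: FC; rewrite defC' fixE inE => /andP[_ ->]; rewrite andbT.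
    move: Cx; rewrite defC; case/rcosetP=> m Mm ->.
    by rewrite groupM // (subsetP sMS).
  rewrite inE => /andP[Sx gx]; exists (M :* x); last exact: rcoset_refl.
  by rewrite fixE gx andbT; apply/rcosetsP; exists x.
- by case/and3P: partS => _ + _; apply: trivIsetS.
- by case/and3P: partS => _ _; apply: contra => /(subsetP sF).
Qed.

(** The transporter of 1 is all of [S], and the factor [#|M|] cancels in the quotient. *)
Lemma perm_char_ratio M g : M \subset S -> g \in S ->
  ((perm_char S M g)%:R / (perm_char S M 1%g)%:R)%R
  = (#|conj_transporter g M|%:R / #|S|%:R :> rat)%R.
Proof.
move=> sMS Sg; have T1 : conj_transporter 1 M = S.
  by apply/setP=> x; rewrite inE group1 andbT.
rewrite -[in RHS]T1 !card_conj_transporter // !natrM -mulf_div divff ?mulr1 //.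
by rewrite pnatr_eq0 -lt0n cardG_gt0.
Qed.

Lemma transporter_le_sigma_elt M g s : M \in max_subgroups S s -> g \in S ->
  (#|conj_transporter g M|%:R / #|S|%:R <= sigma_elt S g s)%R.
Proof.
move=> maxM Sg; rewrite /sigma_elt (bigD1 M) //=.
move: maxM; rewrite inE => /andP[/maxgroupp/proper_sub sMS _].
rewrite -perm_char_ratio // lerDl sumr_ge0 // => L _.
by rewrite divr_ge0 ?ler0n.
Qed.

(** Both [s ^ h] and [g] lie in the proper subgroup [M :^ h]. *)
Lemma sub_transporter_nongen M g s : M \in max_subgroups S s -> g \in S ->
  conj_transporter g M \subset [set h in S | <<[set s ^ h; g]>> != S].
Proof.
rewrite inE => /andP[/maxgroupp prM Ms] Sg.
apply/subsetP=> h; rewrite !inE => /andP[Sh gh]; rewrite Sh /=.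
apply: contraL prM => /eqP defS; rewrite properE negb_and negbK.
apply/orP; right; rewrite -(conjSg _ _ h) (conjGid Sh) -defS gen_subG.
by apply/subsetP=> z /set2P[]-> //; rewrite memJ_conjg.
Qed.

Lemma transporter_le_P_elt M g s : M \in max_subgroups S s -> g \in S ->
  (#|conj_transporter g M|%:R / #|S|%:R <= P_elt S g s)%R.
Proof.
move=> maxM Sg; rewrite ler_pM2r ?invr_gt0 ?ltr0n ?cardG_gt0 // ler_nat.
exact/subset_leq_card/sub_transporter_nongen.
Qed.

Section UniqueMaximal.

Variables (M : {group gT}) (s : gT).
Hypotheses (Ss : s \in S) (maxM : max_subgroups S s = [set M]).

Lemma sigma_elt_unique_max g : g \in S ->
  sigma_elt S g s = (#|conj_transporter g M|%:R / #|S|%:R)%R.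
Proof.
move=> Sg; rewrite /sigma_elt maxM big_set1 perm_char_ratio //.
have: M \in max_subgroups S s by rewrite maxM set11.
by rewrite inE => /andP[/maxgroupp/proper_sub].
Qed.

Lemma nongen_unique_max g : g \in S ->
  [set h in S | <<[set s ^ h; g]>> != S] = conj_transporter g M.
Proof.
move=> Sg; apply/eqP; rewrite eqEsubset sub_transporter_nongen ?maxM ?set11 //.
rewrite andbT; apply/subsetP=> h; rewrite !inE => /andP[Sh neqS].
rewrite Sh /=; have sS : <<[set s ^ h; g]>> \subset S.
  by rewrite gen_subG; apply/subsetP=> z /set2P[]->; rewrite ?groupJ.
have [eqS|[L maxL sL]] := maximal_exists sS; first by rewrite eqS eqxx in neqS.
(* Conjugating back turns a maximal subgroup over [s ^ h] and [g] into one containing [s], which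
   uniqueness identifies with [M]. *)
have LM : (L :^ h^-1)%G \in max_subgroups S s.
  rewrite inE mem_conjg invgK (subsetP sL) ?mem_gen ?set21 // andbT.
  by rewrite -(conjGid (groupVr Sh)) maximalJ.
move: LM; rewrite maxM inE => /eqP <-; rewrite /= conjsgKV.
by rewrite (subsetP sL) ?mem_gen ?set22.
Qed.

Lemma P_elt_unique_max g : g \in S ->
  P_elt S g s = (#|conj_transporter g M|%:R / #|S|%:R)%R.
Proof. by move=> Sg; rewrite /P_elt nongen_unique_max. Qed.

End UniqueMaximal.

Lemma repr_nonid : S :!=: 1 -> repr S^# \in S^#.
Proof. by case/trivgPn=> x Sx ntx; apply: (mem_repr x); rewrite !inE ntx. Qed.

Lemma le_max_nonid f g : g \in S^# -> (f g <= max_nonid S f)%R.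
Proof. by move=> Sg; apply: le_bigmax_cond. Qed.

Lemma max_nonid_eq f g c : g \in S^# -> f g = c ->
  (forall h, h \in S^# -> f h <= c)%R -> max_nonid S f = c.
Proof.
move=> Sg <- lef; apply/eqP; rewrite eq_le le_max_nonid // andbT.
(* The starting value of the iterated maximum must be bounded too; it is a value of [f] on [S^#],
   which [g] shows to be nonempty. *)
apply: bigmax_le => //; apply/lef/repr_nonid; apply/trivgPn; exists g.
  by case/setD1P: Sg.
by case/setD1P: Sg.
Qed.

Lemma min_nonid_eq f g c : g \in S^# -> f g = c ->
  (forall h, h \in S^# -> c <= f h)%R -> min_nonid S f = c.
Proof.
move=> Sg <- lef; apply/eqP; rewrite eq_le; apply/andP; split.
  exact: bigmin_le_cond.
apply: le_bigmin => //; apply/lef/repr_nonid; apply/trivgPn; exists g.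
  by case/setD1P: Sg.
by case/setD1P: Sg.
Qed.

End Transporters.

(** * Elements of order 5 in a simple group of order 60 *)

Section Order60.

Variables (gT : finGroupType) (G : {group gT}).
Hypotheses (simG : simple G) (oG : #|G| = 60).
(** Supplies the involutions that make the normalizers dihedral; [A5_inverted] establishes it for
    [A5] by computation. *)
Hypothesis inverted : forall s, s \in G -> #[s] = 5 ->
  exists y, [/\ y \in G, #[y] = 2 & s ^ y = s^-1].
Implicit Types (s g y : gT) (M : {group gT}).

(** The possible numbers of Sylow 5-subgroups, in [G] and in its subgroups. *)
Lemma divisor60_mod5 n : n %| 60 -> n %% 5 = 1%N -> n = 1%N \/ n = 6.
Proof.
move=> dvn /eqP mod5.
have /allP/(_ n) : all (fun n => (n %| 60) && (n %% 5 == 1%N) ==> (n \in [:: 1%N; 6]))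
                       (iota 0 61) by vm_compute.
rewrite mem_iota ltnS (dvdn_leq _ dvn) // dvn mod5 !inE => /(_ isT).
by case/orP=> /eqP; [left|right].
Qed.

Lemma normal_simple_nontriv M : M <| G -> M != G -> M :=: 1.
Proof.
move=> nMG neM; case/simpleP: simG => _ /(_ M nMG) [] // eqM.
by case/eqP: neM; apply: val_inj.
Qed.

(** The 5-part of 60 is 5. *)
Lemma Sylow5_cycle s M : M \subset G -> s \in M -> #[s] = 5 -> 5.-Sylow(M) <[s]>.
Proof.
move=> sMG Ms os; rewrite pHallE cycle_subG Ms -orderE os eqn_dvd.
have dvM : #|M| %| 60 by rewrite -oG cardSg.
have d5 : 5 %| #|M| by rewrite -os order_dvdG.
have p5 : (5`_5 = 5)%N by rewrite part_pnat_id.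
have p60 : (60`_5 = 5)%N by rewrite p_part.
have := partn_dvd 5 (cardG_gt0 M) d5; have := partn_dvd 5 (isT : 0 < 60) dvM.
by rewrite p5 p60 => -> ->.
Qed.

(** A single Sylow 5-subgroup would be normal, against simplicity. So there are six, and the
    normalizer has index 6. *)
Lemma card_norm5 s : s \in G -> #[s] = 5 -> #|'N_G(<[s]>)| = 10.
Proof.
move=> Gs os; have syl := Sylow5_cycle (subxx G) Gs os.
have := Lagrange (subsetIl G 'N(<[s]>)).
have : #|G : 'N_G(<[s]>)| %| 60 by rewrite -oG dvdn_indexg.
have := card_Syl_mod G (isT : prime 5); rewrite (card_Syl syl).
move=> mod5 /divisor60_mod5/(_ mod5)[] ->; rewrite oG ?muln1 => eqN; last first.
  by apply/eqP; rewrite -(@eqn_pmul2r 6) // eqN.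
have /eqP defN : 'N_G(<[s]>) == G by rewrite eqEcard subsetIl oG eqN.
have ns : <[s]> <| G by rewrite /normal cycle_subG Gs -defN subsetIr.
have neG : <[s]>%G != G.
  by apply/eqP=> eqG; have := oG; rewrite -eqG -orderE os.
by have := os; rewrite orderE (normal_simple_nontriv ns neG) cards1.
Qed.

Lemma max_subgroups_norm5 s : s \in G -> #[s] = 5 ->
  max_subgroups G s = [set 'N_G(<[s]>)%G].
Proof.
move=> Gs os; have oN := card_norm5 Gs os.
have maxE M : M \in max_subgroups G s -> M = 'N_G(<[s]>)%G.
  rewrite inE => /andP[maxM Ms]; have [prM maxP] := maxgroupP maxM.
  have sMG := proper_sub prM; have syl := Sylow5_cycle sMG Ms os.
  have dvM : #|M| %| 60 by rewrite -oG cardSg.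
  have := card_Syl_mod M (isT : prime 5); rewrite (card_Syl syl) => mod5.
  have dvi : #|M : 'N_M(<[s]>)| %| 60 by apply: dvdn_trans dvM; apply: dvdn_indexg.
  (* With one Sylow 5-subgroup, [M] normalizes [<[s]>], and maximality makes it the whole
     normalizer. With six, [M] has order 30, hence index 2, and is normal. *)
  have [/eqP|i6] := divisor60_mod5 dvi mod5.
    rewrite indexg_eq1 subsetI subxx => /= nM.
    apply/val_inj/esym/maxP; last by rewrite subsetI sMG.
    by rewrite properEcard subsetIl oG oN.
  have o30 : 30 %| #|M|.
    rewrite -(Lagrange (subsetIl M 'N(<[s]>))) i6 -[30]/(5 * 6)%N dvdn_pmul2r // -os.
    by rewrite order_dvdG // inE Ms (subsetP (normG _)) ?cycle_id.
  have ltM : #|M| < 60 by rewrite -oG proper_card.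
  have oM : #|M| = 30.
    by case/dvdnP: o30 ltM => [[|[|k]]] eqM; rewrite eqM // in (dvM) *.
  have nM : M <| G.
    apply: index2_normal => //; apply/eqP.
    by rewrite -(@eqn_pmul2l #|M|) ?cardG_gt0 // Lagrange // oG oM.
  have M1 : M :=: 1.
    by apply: normal_simple_nontriv => //; apply/eqP=> eqM; rewrite eqM oG in oM.
  by move: oM; rewrite M1 cards1.
apply/setP=> M; rewrite in_set1; apply/idP/eqP => [/maxE //|->].
(* Maximality of the normalizer comes indirectly: some maximal subgroup contains [s], and by [maxE]
   it is the normalizer. *)
have sCG : <[s]> \subset G by rewrite cycle_subG.
have [eqG|[L maxL sL]] := maximal_exists sCG.
  by have := oG; rewrite -eqG -orderE os.
have maxLs : L \in max_subgroups G s by rewrite inE maxL -cycle_subG.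
by rewrite -(maxE _ maxLs).
Qed.

(** The element [s] and an involution inverting it satisfy the dihedral presentation. They generate
    a subgroup of order divisible by 10, which is the whole normalizer. *)
Lemma norm5_dihedral s : s \in G -> #[s] = 5 -> 'N_G(<[s]>) \isog 'D_10.
Proof.
move=> Gs os; have oN := card_norm5 Gs os.
have [y [Gy oy sy]] := inverted Gs os.
have Ny : y \in 'N_G(<[s]>).
  by rewrite inE Gy; apply/normP; rewrite -cycleJ sy cycleV.
have Ns : s \in 'N_G(<[s]>) by rewrite inE Gs (subsetP (normG _)) ?cycle_id.
rewrite isogEcard oN (@card_dihedral 5) // andbT.
rewrite (@Grp_dihedral 5) //; apply/existsP; exists (s, y) => /=.
rewrite !xpair_eqE; move: (expg_order s) (expg_order y); rewrite os oy.
move=> -> ->; rewrite sy !eqxx !andbT.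
rewrite eqEcard join_subG !cycle_subG Ns Ny oN /=.
have sX : s \in <[s]> <*> <[y]> by rewrite mem_gen // inE cycle_id.
have yX : y \in <[s]> <*> <[y]> by rewrite mem_gen // inE cycle_id orbT.
apply: dvdn_leq; rewrite ?cardG_gt0 // (@Gauss_dvd 2 5) //.
by have := order_dvdG yX; have := order_dvdG sX; rewrite os oy => -> ->.
Qed.

(** The order is a multiple of 5 dividing 10; it is not 10, as the normalizer contains an involution
    inverting [s]. *)
Lemma card_cent5 s : s \in G -> #[s] = 5 -> #|'C_G[s]| = 5.
Proof.
move=> Gs os; have oN := card_norm5 Gs os.
have [y [Gy oy sy]] := inverted Gs os.
have d5 : 5 %| #|'C_G[s]| by rewrite -os order_dvdG // inE Gs cent1id.
have sCN : 'C_G[s] \subset 'N_G(<[s]>) by rewrite setIS // -cent_cycle cent_sub.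
have neCN : #|'C_G[s]| != 10.
  apply/eqP=> oC; have : y \in 'C_G[s].
    have /eqP-> : 'C_G[s] == 'N_G(<[s]>) by rewrite eqEcard sCN oN oC.
    by rewrite inE Gy; apply/normP; rewrite -cycleJ sy cycleV.
  rewrite inE => /andP[_ /cent1P cys].
  have : s ^+ 2 = 1.
    by rewrite expgS expg1 -{1}[s]invgK -sy conjgE -cys mulKg mulVg.
  by move/eqP; rewrite -order_dvdn os.
have := cardSg sCN; move: neCN; rewrite oN.
by case/dvdnP: d5 => [[|[|[|k]]]] ->.
Qed.

(** The fibres of [x] to [g ^ x^-1], from the transporter onto the conjugates of [g] in [M], are
    left cosets of the centralizer. *)
Lemma card_conj_transporter_class g M : g \in G ->
  #|conj_transporter G g M| = (#|M :&: g ^: G| * #|'C_G[g]|)%N.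
Proof.
move=> Gg; rewrite -sum1_card (partition_big (fun x => g ^ x^-1) (mem (M :&: g ^: G))) /=.
  rewrite -sum_nat_const; apply: eq_bigr => k /setIP[Mk kG].
  case/imsetP: kG Mk => u Gu -> Mu {k}.
  rewrite sum1_card -(card_lcoset _ u^-1); apply: eq_card => x.
  rewrite mem_lcoset invgK unfold_in /= [x \in conj_transporter _ _ _]inE.
  rewrite [_ \in 'C_G[_]]inE (groupMl _ Gu) mem_conjg.
  have -> : (u * x \in 'C[g]) = (g ^ x^-1 == g ^ u).
    rewrite -(inj_eq (@conjg_inj _ x)) conjgKV -conjgM eq_sym.
    by rewrite cent1C (sameP cent1P commgP) (sameP conjg_fixP eqP).
  apply/idP/idP => [/andP[/andP[-> _]] //|/andP[-> /eqP gx]].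
  by rewrite gx Mu eqxx.
move=> x; rewrite inE mem_conjg => /andP[Gx Mgx].
by rewrite /= inE Mgx /= imset_f ?groupV.
Qed.

Lemma norm5_order5_mem s z : s \in G -> #[s] = 5 -> z \in 'N_G(<[s]>) ->
  #[z] = 5 -> z \in <[s]>.
Proof.
move=> Gs os Nz oz; have Ns : s \in 'N_G(<[s]>).
  by rewrite inE Gs (subsetP (normG _)) ?cycle_id.
have sylN := Sylow5_cycle (subsetIl G _) Ns os.
have nsN : <[s]> <| 'N_G(<[s]>) by rewrite /normal cycle_subG Ns subsetIr.
by rewrite (mem_normal_Hall sylN nsN Nz) /p_elt oz.
Qed.

(** A power of [g] has order 5, and its centralizer, of order 5, contains that of [g]. *)
Lemma card_cent_order5_multiple g : g \in G -> 5 %| #[g] -> #|'C_G[g]| = 5 /\ #[g] = 5.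
Proof.
move=> Gg d5; have Gt : g ^+ (#[g] %/ 5) \in G by rewrite groupX.
have ot : #[g ^+ (#[g] %/ 5)] = 5.
  by rewrite orderXdiv ?dvdn_div // divnA // mulKn.
have ct := card_cent5 Gt ot.
have sC : 'C_G[g] \subset 'C_G[g ^+ (#[g] %/ 5)].
  by rewrite setIS // -!cent_cycle centS // cycleX.
have := cardSg sC; rewrite ct => dC.
have dg : #[g] %| #|'C_G[g]| by rewrite order_dvdG // inE Gg cent1id.
split; apply/eqP; rewrite eqn_dvd.
  by rewrite dC (dvdn_trans d5).
by rewrite d5 (dvdn_trans dg).
Qed.

(** The 20 arises as 5 conjugates of [y] in the normalizer times a centralizer of order 4. *)
Lemma card_transporter_invol s y : s \in G -> #[s] = 5 ->
  y \in 'N_G(<[s]>) -> #[y] = 2 -> #|conj_transporter G y 'N_G(<[s]>)| = 20.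
Proof.
move=> Gs os Ny oy; have oN := card_norm5 Gs os.
have Gy : y \in G by case/setIP: Ny.
have Ns : s \in 'N_G(<[s]>) by rewrite inE Gs (subsetP (normG _)) ?cycle_id.
have sSN : <[s]> \subset 'N_G(<[s]>) by rewrite cycle_subG.
have n5C : ~~ (5 %| #|'C_G[y]|).
  apply/negP=> /(Cauchy (isT : prime 5))[t /setIP[Gt cyt] ot].
  have := card_cent5 Gt ot; have : 2 %| #|'C_G[t]|.
    by rewrite -oy order_dvdG // inE Gy cent1C.
  by move=> + ct; rewrite ct.
have oK : #|'N_G(<[s]>) :&: y ^: G| = 5.
  (* At most 5: conjugates of [y] avoid [<[s]>], which leaves 10 - 5 elements. At least 5: by [n5C]
     no nontrivial element of [<[s]>] centralizes [y], so its class under [<[s]>] has 5 elements. *)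
  apply/eqP; rewrite eqn_leq; apply/andP; split.
    rewrite -[5]/(10 - 5)%N -{2}os -oN orderE -cardsDS //.
    apply: subset_leq_card; apply/subsetP=> z /setIP[Nz /imsetP[u _ zE]].
    rewrite inE Nz andbT; apply/negP=> /order_dvdG.
    by rewrite -orderE zE orderJ oy os.
  have ycl : #|y ^: <[s]>| = 5.
    rewrite -index_cent1 -[RHS]os orderE -(Lagrange (subsetIl <[s]> 'C[y])).
    suff -> : #|'C_<[s]>[y]| = 1%N by rewrite mul1n.
    have := cardSg (subsetIl <[s]> 'C[y]); rewrite -orderE os.
    have /primeP[_ P5] := isT : prime 5; case/P5/orP=> /eqP // c5.
    by case/negP: n5C; rewrite -[X in X %| _]c5 cardSg // setSI // cycle_subG.
  rewrite -[X in X <= _]ycl; apply: subset_leq_card; apply/subsetP=> _ /imsetP[u su ->].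
  have Nu := subsetP sSN _ su.
  by rewrite inE groupJ // memJ_class //; case/setIP: Nu.
rewrite card_conj_transporter_class // oK; suff -> : #|'C_G[y]| = 4 by [].
(* The involution [y] lies in a Sylow 2-subgroup of order 4, which is abelian and so centralizes
   [y]. *)
have d4 : 4 %| #|'C_G[y]|.
  have [P sylP] := Sylow_exists 2 G.
  have oP : #|P| = 4 by rewrite (card_Hall sylP) oG p_part.
  have y2 : 2.-elt y by rewrite /p_elt oy.
  have := Sylow_subJ sylP; move/(_ <[y]>%G); rewrite cycle_subG => /(_ Gy y2)[u Gu].
  rewrite /= cycle_subG => sy.
  have abP : abelian (P :^ u) by rewrite abelianJ (@card_p2group_abelian _ 2) // oP.
  rewrite -oP -(cardJg P u); apply: cardSg; rewrite subsetI sub_cent1 /=.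
  rewrite (subsetP abP _ sy) andbT.
  by rewrite -(conjGid Gu) conjSg (pHall_sub sylP).
have dC : #|'C_G[y]| %| 12.
  have := cardSg (subsetIl G 'C[y]); rewrite oG -[60]/(12 * 5)%N Gauss_dvdl //.
  by rewrite coprime_sym prime_coprime.
(* Otherwise the transporter has 5 * 12 = 60 elements, so [y] lies in every conjugate of the
   normalizer, that is, in its core, which is trivial by simplicity. *)
have nC12 : #|'C_G[y]| != 12.
  apply/eqP=> oC; pose K := gcore 'N_G(<[s]>) G.
  have TG : conj_transporter G y 'N_G(<[s]>) = G.
    apply/eqP; rewrite eqEcard; apply/andP; split.
      by apply/subsetP=> u; rewrite inE => /andP[].
    by rewrite card_conj_transporter_class // oK oC oG.
  have Ky : y \in K.
    by apply/bigcapP=> u; rewrite -{1}TG inE => /andP[].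
  have nsK : K <| G by apply: gcore_normal; apply: subsetIl.
  have neK : (gcore_group 'N_G(<[s]>) G) != G.
    apply/eqP=> eqK; have : #|K| <= 10.
      by rewrite -oN; apply/subset_leq_card/gcore_sub.
    by rewrite -[K]/(gval (gcore_group _ _)) eqK oG.
  have K1 : K = 1 := normal_simple_nontriv nsK neK.
  move: Ky; rewrite K1 => /set1P y1.
  by move: oy; rewrite y1 order1.
case/dvdnP: d4 dC nC12 => k -> ; rewrite -[12]/(3 * 4)%N dvdn_pmul2r // => dk.
by have /primeP[_ P3] := isT : prime 3; case/P3/orP: dk => /eqP->.
Qed.

(** If 5 divides the order of [g], its conjugates in the normalizer are among the 4 nontrivial
    elements of [<[s]>], and its centralizer has order 5. Otherwise a conjugate [z] of [g] in the
    normalizer is an involution, and the transporter of [g] is contained in a translate of that of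
    [z]. *)
Lemma card_transporter_le s g : s \in G -> #[s] = 5 -> g \in G^# ->
  #|conj_transporter G g 'N_G(<[s]>)| <= 20.
Proof.
move=> Gs os /setD1P[ntg Gg]; have oN := card_norm5 Gs os.
have [->|[x]] := set_0Vmem (conj_transporter G g 'N_G(<[s]>)).
  by rewrite cards0.
rewrite inE mem_conjg => /andP[Gx]; set z := g ^ x^-1 => Nz.
have ozg : #[z] = #[g] by rewrite orderJ.
have [d5|n5] := boolP (5 %| #[g]).
  have [cg og] := card_cent_order5_multiple Gg d5.
  rewrite card_conj_transporter_class // cg -[20]/(4 * 5)%N leq_mul2r /=.
  have <- : #|<[s]>^#| = 4.
    by apply: succn_inj; rewrite -os orderE (cardsD1 1 <[s]>) group1.
  apply: subset_leq_card; apply/subsetP=> t /setIP[Nt /imsetP[u _ tE]].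
  have ot : #[t] = 5 by rewrite tE orderJ.
  by rewrite !inE -order_eq1 ot norm5_order5_mem.
have oz : #[z] = 2.
  have : #[z] %| 2 * 5 by rewrite -[(2 * 5)%N]oN order_dvdG.
  rewrite Gauss_dvdl ?ozg; last by rewrite coprime_sym prime_coprime.
  have /primeP[_ P2] := isT : prime 2; case/P2/orP=> /eqP // og1.
  by rewrite -order_eq1 og1 in ntg.
rewrite -(card_transporter_invol Gs os Nz oz).
rewrite -[X in _ <= X](card_rcoset _ x) subset_leq_card //.
apply/subsetP=> t; rewrite inE mem_conjg => /andP[Gt gt].
rewrite mem_rcoset inE groupM ?groupV //= mem_conjg /z -conjgM.
by rewrite invMg invgK mulgA mulVg mul1g.
Qed.

End Order60.

(** * Computation with permutations of five points *)

Section PermutationWords.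

(* Finite facts on permutations of five points are checked by computation on
   the words listing the images of 0, ..., 4. *)
Definition word (p : {perm 'I_5}) : seq nat := [seq (p i : nat) | i <- enum 'I_5].

Definition word1 : seq nat := iota 0 5.

(** Permutations act on the right, so [a] is applied first. *)
Definition word_mul (a b : seq nat) : seq nat := [seq nth 0 b i | i <- a].

Definition word_tperm (i j : nat) : seq nat :=
  [seq if k == i then j else if k == j then i else k | k <- word1].

Fixpoint odd_inversions (a : seq nat) : bool :=
  if a is i :: a' then odd (count (fun j => j < i) a') (+) odd_inversions a'
  else false.

Definition words : seq (seq nat) := permutations word1.

Lemma nth_word p (i : 'I_5) : nth 0 (word p) i = p i.
Proof.
by rewrite (nth_map i) ?size_enum_ord // nth_ord_enum.
Qed.

Lemma word_inj : injective word.
Proof. by move=> p q eqpq; apply/permP=> i; apply: val_inj; rewrite /= -!nth_word eqpq. Qed.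

Lemma word_in p : word p \in words.
Proof.
rewrite mem_permutations uniq_perm ?iota_uniq //.
  by rewrite map_inj_uniq ?enum_uniq // => i j /val_inj/perm_inj.
move=> k; rewrite mem_iota /=; apply/mapP/idP => [[i _ ->] //|ltk].
exists (p^-1 (Ordinal ltk)); first by rewrite mem_enum.
by rewrite permKV.
Qed.

Lemma wordP a : a \in words -> exists p, word p = a.
Proof.
rewrite mem_permutations => pa.
have sa : size a = 5 by rewrite (perm_size pa) size_iota.
have ua : uniq a by rewrite (perm_uniq pa) iota_uniq.
have lta i : i < 5 -> nth 0 a i < 5.
  move=> lti; have : nth 0 a i \in a by rewrite mem_nth ?sa.
  by rewrite (perm_mem pa) mem_iota.
have injf : injective (fun i : 'I_5 => Ordinal (lta i (ltn_ord i))).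
  move=> i j [] /eqP; rewrite nth_uniq ?sa ?ltn_ord // => /eqP.
  exact: val_inj.
exists (perm injf); apply: (@eq_from_nth _ 0) => [|i].
  by rewrite size_map size_enum_ord sa.
rewrite size_map size_enum_ord => lti.
by rewrite -[i]/(Ordinal lti : nat) nth_word permE.
Qed.

Lemma wordM p q : word (p * q) = word_mul (word p) (word q).
Proof.
by rewrite /word_mul /word -map_comp; apply: eq_map => i /=; rewrite nth_word permM.
Qed.

Lemma word_one : word 1 = word1.
Proof.
by rewrite /word1 -val_enum_ord; apply: eq_map => i; rewrite perm1.
Qed.

Lemma word_eq1 p : (p == 1) = (word p == word1).
Proof. by rewrite -word_one (inj_eq word_inj). Qed.

Lemma word_tpermE (i j : 'I_5) : word (tperm i j) = word_tperm i j.
Proof.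
rewrite /word_tperm /word1 -val_enum_ord -map_comp; apply: eq_map => k /=.
by rewrite permE /= !(inj_eq val_inj); do 2?case: ifP.
Qed.

Lemma odd_inversions_tperm : all (fun a => all (fun i => all (fun j => (i != j) ==>
    (odd_inversions (word_mul (word_tperm i j) a) == ~~ odd_inversions a))
  word1) word1) words.
Proof. by vm_compute. Qed.

(** Induction on a product of transpositions: each new factor flips both parities. *)
Lemma odd_permE (p : {perm 'I_5}) : odd_perm p = odd_inversions (word p).
Proof.
have [ts -> dts] := prod_tpermP p; elim: ts dts => [|[i j] ts IH] /=.
  by rewrite big_nil odd_perm1 word_one.
case/andP=> neij /IH{}IH; rewrite big_cons odd_mul_tperm IH /=.
set q := \prod_(_ <- _) _; rewrite wordM word_tpermE.
have /allP/(_ _ (word_in q))/allP/(_ (i : nat)) := odd_inversions_tperm.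
rewrite mem_iota ltn_ord => /(_ isT)/allP/(_ (j : nat)).
rewrite mem_iota ltn_ord => /(_ isT)/implyP/(_ neij)/eqP ->.
by rewrite [i != j]neij.
Qed.

Lemma mem_A5 p : (p \in A5) = ~~ odd_inversions (word p).
Proof. by rewrite Alt_even odd_permE. Qed.

Definition word5 a := word_mul a (word_mul a (word_mul a (word_mul a a))).

Lemma word_expg5 p : (p ^+ 5 == 1) = (word5 (word p) == word1).
Proof. by rewrite word_eq1 !expgS expg0 mulg1 !wordM. Qed.

(* For an involution b, this says that conjugation by b inverts a. *)
Definition inverts b a := word_mul (word_mul b a) (word_mul b a) == word1.

Lemma inverts_word b a : (b * a) ^+ 2 = 1 <-> inverts (word b) (word a).
Proof.
by rewrite /inverts -!wordM -word_eq1 expgS expg1; split=> /eqP.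
Qed.

(** A permutation of five points without fixed points is a 5-cycle or has cycle type 3 + 2, and the
    latter is odd. *)
Lemma derangement_word5 : all (fun a =>
    ~~ odd_inversions a && all (fun i => nth 0 a i != i) word1 ==> (word5 a == word1))
  words.
Proof. by vm_compute. Qed.

(** A reflection of the pentagon inverts its rotations; it is a double transposition, hence even. *)
Lemma inverted_word5 : all (fun a => (word5 a == word1) && (a != word1) ==>
    has (fun b => [&& ~~ odd_inversions b, b != word1, word_mul b b == word1
                    & inverts b a]) words)
  words.
Proof. by vm_compute. Qed.

Lemma A5_fixpoint p : p \in A5 -> #[p] <> 5 -> exists i, p i = i.
Proof.
rewrite mem_A5 => evp op; have [/existsP[i /eqP pi]|] := boolP [exists i, p i == i].
  by exists i.
rewrite negb_exists => /forallP nofix; case: op; apply: nt_prime_order => //.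
  apply/eqP; rewrite word_expg5; have /allP/(_ _ (word_in p)) := derangement_word5.
  rewrite evp andTb => /implyP; apply; apply/allP=> i; rewrite mem_iota => lti.
  by rewrite -[i]/(Ordinal lti : nat) nth_word (inj_eq val_inj).
by apply: contra (nofix ord0) => /eqP->; rewrite perm1.
Qed.

Lemma A5_inverted s : s \in A5 -> #[s] = 5 ->
  exists y, [/\ y \in A5, #[y] = 2 & s ^ y = s^-1].
Proof.
move=> _ os; have /allP/(_ _ (word_in s))/implyP := inverted_word5.
have s5 : s ^+ 5 == 1 by rewrite -order_dvdn os.
rewrite -word_expg5 -word_eq1 s5 -order_eq1 os andTb => /(_ isT).
case/hasP=> a /wordP[y <-] /and4P[Ay nty]; rewrite -wordM -word_eq1 => y2 /inverts_word invy.
have oy : #[y] = 2.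
  by apply: nt_prime_order; rewrite // ?word_eq1 // expgS expg1; apply/eqP.
exists y; rewrite mem_A5; split=> //.
have yV : y^-1 = y by apply/eqP; rewrite eq_invg_mul.
apply: (mulIg s); rewrite mulVg conjgE yV -invy.
by rewrite expgS expg1 !mulgA.
Qed.

End PermutationWords.

(** * A criterion for not generating, and the point stabilizers of [A5] *)

(** Since [x] inverts [g], generation would make [<[g]>] normal, hence trivial or all of [G]. Either
    way [G] would be cyclic. *)
Lemma gen_inverted_proper (gT : finGroupType) (G : {group gT}) (g x : gT) :
  simple G -> ~~ abelian G -> g \in G -> x \in G ->
  x ^+ 2 = 1 -> (x * g) ^+ 2 = 1 -> <<[set g; x]>> \proper G.
Proof.
move=> simG nabG Gg Gx x2 xg2.
have xV : x^-1 = x by apply/eqP; rewrite eq_invg_mul -x2 expgS expg1.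
have gx : g ^ x = g^-1.
  by apply: (mulIg g); rewrite mulVg conjgE xV -xg2 expgS expg1 !mulgA.
have sG : <<[set g; x]>> \subset G.
  by rewrite gen_subG; apply/subsetP=> z /set2P[]->.
rewrite properEneq sG andbT; apply: contra nabG => /eqP defG.
have nsg : <[g]> <| G.
  rewrite /normal cycle_subG Gg -defG gen_subG; apply/subsetP=> z /set2P[]->.
    by rewrite (subsetP (normG _)) ?cycle_id.
  by apply/normP; rewrite -cycleJ gx cycleV.
case/simpleP: simG => _ /(_ <[g]>%G nsg) [] /= gE; last first.
  by rewrite -gE cycle_abelian.
apply: abelianS (cycle_abelian x).
rewrite -defG gen_subG; apply/subsetP=> z /set2P[]->; last exact: cycle_id.
have /set1P-> : g \in [1 gT] by rewrite -gE cycle_id.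
exact: group1.
Qed.

Lemma simple_A5 : simple A5.
Proof. by apply: simple_Alt5; rewrite card_ord. Qed.

Lemma card_A5 : #|A5| = 60.
Proof.
apply/eqP; rewrite -(@eqn_pmul2l 2) //.
by have := @card_Alt 'I_5; rewrite card_ord => ->.
Qed.

Lemma A5_nonabelian : ~~ abelian A5.
Proof.
apply/negP=> /abelian_sol; rewrite /A5 /= solvable_AltF ?card_ord //.
Qed.

Definition A5_stab (i : 'I_5) : {group {perm 'I_5}} := 'C_A5[i | 'P]%G.

Lemma mem_A5_stab i p : (p \in A5_stab i) = (p \in A5) && (p i == i).
Proof. by rewrite inE (sameP astab1P eqP). Qed.

Lemma A5_transitive2 : [transitive^2 A5, on [set: 'I_5] | 'P].
Proof.
have := Alt_trans 'I_5; rewrite card_ord => tr3.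
exact: ntransitive_weak tr3.
Qed.

Lemma A5_transitive : [transitive A5, on [set: 'I_5] | 'P].
Proof. by apply: ntransitive1 A5_transitive2. Qed.

Lemma card_A5_stab i : #|A5_stab i| = 12.
Proof.
apply/eqP; rewrite -(@eqn_pmul2l 5) // -[(5 * 12)%N]/60 -card_A5 -(card_orbit_stab 'P A5 i).
by rewrite (atransP A5_transitive) ?inE // cardsT card_ord.
Qed.

Lemma A5_stab_proper i : A5_stab i \proper A5.
Proof. by rewrite properEcard subsetIl card_A5_stab card_A5. Qed.

(** A 2-transitive action is primitive, so a point stabilizer is maximal or everything. *)
Lemma A5_stab_maximal i : maximal (A5_stab i) A5.
Proof.
have := ntransitive_primitive (isT : 1 < 2) A5_transitive2.
rewrite (trans_prim_astab (in_setT i) A5_transitive) => /orP[/eqP eqS|//].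
by have := A5_stab_proper i; rewrite /= eqS properxx.
Qed.

Lemma card_A5_move (i j : 'I_5) : #|[set x : {perm 'I_5} in A5 | x i == j]| = 12.
Proof.
have [a Aa ->] := atransP2 A5_transitive (in_setT i) (in_setT j).
rewrite -(card_A5_stab i) -(card_rcoset (A5_stab i) a); apply: eq_card => x.
rewrite mem_rcoset mem_A5_stab inE groupMr ?groupV // permM.
by rewrite -[in RHS](inj_eq (@perm_inj _ a)) permKV.
Qed.

(** The conjugate of the stabilizer of [i] by [x] is that of [x i], so every [x] taking [i] to [j]
    or [k] counts: 12 + 12 elements. *)
Lemma A5_stab_transporter_ge (g : {perm 'I_5}) (i j k : 'I_5) :
  g \in A5 -> j != k -> g j = j -> g k = k ->
  24 <= #|conj_transporter A5 g (A5_stab i)|.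
Proof.
move=> Ag neqjk gj gk; set X := [set x : {perm 'I_5} in A5 | x i == j].
set Y := [set x : {perm 'I_5} in A5 | x i == k].
have XY0 : X :&: Y = set0.
  apply/setP=> x; rewrite !inE; apply/negP=> /andP[/andP[_ /eqP xj] /andP[_ /eqP xk]].
  by rewrite -xj -xk eqxx in neqjk.
have := cardsU X Y; rewrite XY0 cards0 subn0 !card_A5_move => oXY.
rewrite -[24]/(12 + 12)%N -oXY.
apply: subset_leq_card.
apply/subsetP=> x Xx; have [Ax gx] : x \in A5 /\ g (x i) = x i.
  by case/setUP: Xx; rewrite in_set => /andP[Ax /eqP->].
rewrite in_set Ax mem_conjg mem_A5_stab groupJ ?groupV //.
by rewrite conjgE invgK !permM (canF_eq (permKV x)) gx eqxx.
Qed.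

Lemma A5_two_fixed : exists g (j k : 'I_5), [/\ g \in A5^#, j != k, g j = j & g k = k].
Proof.
pose o i : 'I_5 := inord i.
have oE i j : i < 5 -> j < 5 -> (o i == o j) = (i == j).
  by move=> lti ltj; rewrite -(inj_eq val_inj) /= !inordK.
(* A 3-cycle on 0, 1, 2. *)
exists (tperm (o 0) (o 1%N) * tperm (o 1%N) (o 2)), (o 3), (o 4); split.
- apply/setD1P; split; last by rewrite Alt_even odd_permM !odd_tperm !oE.
  apply/eqP=> /permP/(_ (o 0)); rewrite permM !tpermL perm1 => /eqP.
  by rewrite oE.
- by rewrite oE.
- by rewrite permM !tpermD // oE.
- by rewrite permM !tpermD // oE.
Qed.

(** * The values of sigma and P on [A5] *)

Lemma third_ratio : (1 / 3 = 20%:R / #|A5|%:R :> rat)%R.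
Proof. by rewrite card_A5. Qed.

Lemma invr_card_A5_gt0 : (0 < #|A5|%:R^-1 :> rat)%R.
Proof. by rewrite invr_gt0 ltr0n cardG_gt0. Qed.

(** An abstract [f] lets the same argument serve [sigma_elt] and [P_elt]. The strict inequality is
    24 > 20. *)
Lemma lt_max_nonid_fixpoint (f : {perm 'I_5} -> {perm 'I_5} -> rat) s :
  (forall g M, M \in max_subgroups A5 s -> g \in A5 ->
    (#|conj_transporter A5 g M|%:R / #|A5|%:R <= f g s)%R) ->
  s \in A5 -> #[s] <> 5 -> (1 / 3 < max_nonid A5 (f^~ s))%R.
Proof.
move=> lef As os; have [i si] := A5_fixpoint As os.
have maxS : A5_stab i \in max_subgroups A5 s.
  by rewrite inE A5_stab_maximal mem_A5_stab As si /=.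
have [g [j [k [Ag neqjk gj gk]]]] := A5_two_fixed.
have Ag' : g \in A5 by case/setD1P: Ag.
apply: (lt_le_trans _ (le_max_nonid _ Ag)).
apply: (lt_le_trans _ (lef _ _ maxS Ag')).
rewrite third_ratio (ltr_pM2r invr_card_A5_gt0) ltr_nat.
exact: leq_trans (A5_stab_transporter_ge i Ag' neqjk gj gk).
Qed.

(** The maximum is attained at an involution inverting [s]. *)
Lemma max_nonid_order5 (f : {perm 'I_5} -> {perm 'I_5} -> rat) s :
  (forall g M, max_subgroups A5 s = [set M] -> g \in A5 ->
    (f g s = #|conj_transporter A5 g M|%:R / #|A5|%:R)%R) ->
  s \in A5 -> #[s] = 5 -> max_nonid A5 (f^~ s) = (1 / 3)%R.
Proof.
move=> fE As os; have [y [Ay oy sy]] := A5_inverted As os.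
have maxE := max_subgroups_norm5 simple_A5 card_A5 As os.
have Ny : y \in 'N_A5(<[s]>).
  by rewrite inE Ay; apply/normP; rewrite -cycleJ sy cycleV.
have Ay' : y \in A5^# by apply/setD1P; rewrite -order_eq1 oy.
apply: (max_nonid_eq Ay') => [|h Ah].
  rewrite (fE _ _ maxE Ay) third_ratio.
  by rewrite (card_transporter_invol simple_A5 card_A5 A5_inverted As os Ny oy).
have Ah' : h \in A5 by case/setD1P: Ah.
rewrite (fE _ _ maxE Ah') third_ratio (ler_pM2r invr_card_A5_gt0) ler_nat.
exact: (card_transporter_le simple_A5 card_A5 A5_inverted As os Ah).
Qed.

Lemma A5_order5 : exists2 s, s \in A5 & #[s] = 5.
Proof.
have [|s As os] := @Cauchy _ 5 A5 isT; first by rewrite card_A5.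
by exists s.
Qed.

Lemma A5_order5_nonid s : s \in A5 -> #[s] = 5 -> s \in A5^#.
Proof. by move=> As os; apply/setD1P; rewrite -order_eq1 os. Qed.

Lemma min_nonid_order5 (f : {perm 'I_5} -> rat) :
  (forall s, s \in A5 -> #[s] = 5 -> f s = (1 / 3)%R) ->
  (forall s, s \in A5 -> #[s] <> 5 -> (1 / 3 < f s)%R) ->
  min_nonid A5 f = (1 / 3)%R /\
  forall s, s \in A5^# -> (f s = (1 / 3)%R <-> #[s] = 5).
Proof.
move=> f5 fn5; split.
  have [s As os] := A5_order5.
  apply: (min_nonid_eq (A5_order5_nonid As os) (f5 s As os)) => h /setD1P[_ Ah].
  by have [oh|/eqP/(fn5 h Ah)/ltW] := eqVneq #[h] 5; first by rewrite f5.
move=> s /setD1P[_ As]; split=> [fs|]; last exact: f5.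
apply/eqP/negPn/negP=> /eqP/(fn5 s As).
by rewrite fs ltxx.
Qed.

Lemma sigma_class_order5 s : s \in A5 -> #[s] = 5 -> sigma_class A5 s = (1 / 3)%R.
Proof.
move=> As; apply: max_nonid_order5 => // g M maxM Ag.
exact: sigma_elt_unique_max.
Qed.

Lemma sigma_class_gt s : s \in A5 -> #[s] <> 5 -> (1 / 3 < sigma_class A5 s)%R.
Proof.
apply: (@lt_max_nonid_fixpoint (sigma_elt A5)) => g M maxM Ag.
exact: transporter_le_sigma_elt.
Qed.

Lemma P_class_order5 s : s \in A5 -> #[s] = 5 -> P_class A5 s = (1 / 3)%R.
Proof.
move=> As; apply: max_nonid_order5 => // g M maxM Ag.
exact: P_elt_unique_max.
Qed.

Lemma P_class_gt s : s \in A5 -> #[s] <> 5 -> (1 / 3 < P_class A5 s)%R.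
Proof.
apply: (@lt_max_nonid_fixpoint (P_elt A5)) => g M maxM Ag.
exact: transporter_le_P_elt.
Qed.

(** * The three double transpositions fixing the point 5 *)

Definition klein_seq := [:: dtransp 1 2 3 4; dtransp 1 3 2 4; dtransp 1 4 2 3].

Definition klein_words :=
  [:: [:: 1%N; 0; 3; 2; 4]; [:: 2; 3; 0; 1%N; 4]; [:: 3; 2; 1%N; 0; 4]]%N.

Lemma word_dtransp a b c d : a <= 5 -> b <= 5 -> c <= 5 -> d <= 5 ->
  word (dtransp a b c d) =
  word_mul (word_tperm a.-1 b.-1) (word_tperm c.-1 d.-1).
Proof.
have ltP k : k <= 5 -> k.-1 < 5 by case: k.
by move=> /ltP la /ltP lb /ltP lc /ltP ld; rewrite wordM !word_tpermE /pt !inordK.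
Qed.

Lemma word_klein_seq : map word klein_seq = klein_words.
Proof. by rewrite /= !word_dtransp. Qed.

(** A 3-cycle (5,a,b) is inverted by (a,b)(c,d), and a 5-cycle (5,a,b,c,d) by (a,d)(b,c). The letter
    4 stands for the point 5. *)
Lemma klein_words_nongen : all (fun a => ~~ odd_inversions a ==>
    [|| nth 0 a 4 == 4, word_mul a a == word1 | has (inverts^~ a) klein_words])
  words.
Proof. by vm_compute. Qed.

Lemma klein_seqP x : x \in klein_seq -> [/\ x \in A5^#, x ^+ 2 = 1 & x (inord 4) = inord 4].
Proof.
move=> Kx; have : word x \in klein_words by rewrite -word_klein_seq map_f.
have /allP chk : all (fun a => [&& ~~ odd_inversions a, a != word1,
  word_mul a a == word1 & nth 0 a 4 == 4]) klein_words by vm_compute.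
move/chk=> /and4P[Ax ntx x2 x4]; split.
- by apply/setD1P; rewrite word_eq1 mem_A5.
- by apply/eqP; rewrite word_eq1 expgS expg1 wordM.
- by apply/val_inj/eqP; rewrite /= -nth_word inordK.
Qed.

Lemma klein_nongen g : g \in A5 ->
  exists2 x, x \in klein_seq & <<[set g; x]>> \proper A5.
Proof.
move=> Ag; have K1 : dtransp 1 2 3 4 \in klein_seq by rewrite mem_head.
have inA5 x : x \in klein_seq -> x \in A5 by case/klein_seqP=> /setD1P[].
have genP := @gen_inverted_proper _ A5 _ _ simple_A5 A5_nonabelian.
have /allP/(_ _ (word_in g)) := klein_words_nongen.
rewrite -mem_A5 Ag -wordM -word_eq1 => /or3P[g4|/eqP g2|].
- exists (dtransp 1 2 3 4) => //; apply: sub_proper_trans (A5_stab_proper (inord 4)).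
  rewrite gen_subG; apply/subsetP=> z /set2P[]->; rewrite mem_A5_stab.
    by rewrite Ag -val_eqE /= -nth_word inordK.
  by case/klein_seqP: (K1) => /setD1P[_ ->] _ -> /=.
(* As [g] has square 1, [x] inverts [x * g], and [x * g] and [x] generate the same subgroup as [g]
   and [x]. *)
- exists (dtransp 1 2 3 4) => //; set x := dtransp 1 2 3 4.
  have [_ x2 _] := klein_seqP K1.
  apply: sub_proper_trans (genP (x * g) x _ (inA5 _ K1) x2 _).
  + have Xx : x \in <<[set x * g; x]>> by rewrite mem_gen ?set22.
    have Xxg : x * g \in <<[set x * g; x]>> by rewrite mem_gen ?set21.
    rewrite gen_subG; apply/subsetP=> z /set2P[]-> //.
    by have := groupM (groupVr Xx) Xxg; rewrite mulKg.
  + by rewrite groupM // inA5.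
  + by rewrite mulgA -[x * x]/(x ^+ 2) x2 mul1g expgS expg1.
- rewrite -word_klein_seq has_map => /hasP[x Kx /inverts_word xg2].
  exists x => //; have [_ x2 _] := klein_seqP Kx.
  exact: genP (inA5 _ Kx) x2 xg2.
Qed.

(** * Spread and uniform spread *)

Lemma spread_ge_inS (gT : finGroupType) (G : {group gT}) (C : {set gT}) k :
  C \subset G -> spread_ge_in G C k -> spread_ge G k.
Proof.
by move=> sCG spC g Gg; have [s Cs gs] := spC g Gg; exists s; rewrite ?(subsetP sCG).
Qed.

Lemma A5_not_spread3 : ~ spread_ge A5 3.
Proof.
(* The default 1 of [nth] is never reached, as the list has three entries. *)
move/(_ (fun i : 'I_3 => nth 1 klein_seq i)) => [i|s As gens].
  by have [] := @klein_seqP (nth 1 klein_seq i) (@mem_nth _ _ klein_seq _ (ltn_ord i)).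
have [x /(nthP 1)[k ltk <-]] := klein_nongen As.
by rewrite setUC (gens (Ordinal ltk)) properxx.
Qed.

Lemma A5_spread2_class s : s \in A5 -> #[s] = 5 -> spread_ge_in A5 (s ^: A5) 2.
Proof.
move=> As os g Ag; have maxE := max_subgroups_norm5 simple_A5 card_A5 As os.
pose B i := [set h in A5 | <<[set s ^ h; g i]>> != A5].
have leB i : #|B i| <= 20.
  rewrite /B (nongen_unique_max As maxE); last by case/setD1P: (Ag i).
  exact: (card_transporter_le simple_A5 card_A5 A5_inverted As os (Ag i)).
pose i0 : 'I_2 := ord0; pose i1 : 'I_2 := ord_max.
(* The two bad sets cover at most 20 + 20 < 60 elements. *)
have [h Ah nBh] : exists2 h, h \in A5 & h \notin B i0 :|: B i1.
  apply/subsetPn/negP=> /subset_leq_card; rewrite card_A5 => le60.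
  have := leq_trans le60 (leq_card_setU (B i0) (B i1)).1.
  by rewrite leqNgt (leq_ltn_trans (leq_add (leB i0) (leB i1))).
exists (s ^ h) => [|i]; first exact: memJ_class.
have : h \notin B i.
  move: nBh; rewrite in_setU negb_or => /andP[n0 n1].
  by have [->|->] : i = i0 \/ i = i1;
    first by case: i => [[|[|//]] lti]; [left|right]; apply: val_inj.
by rewrite in_set Ah /= negbK setUC => /eqP.
Qed.


Theorem mainTheorem4 :
  (* (a) *)
  (sigma A5 = (1 / 3)%R /\
   forall s, s \in A5^# -> (sigma_class A5 s = (1 / 3)%R <-> #[s] = 5)) /\
  (* (b) *)
  (forall s, s \in A5 -> #[s] = 5 ->
   exists2 M : {group {perm 'I_5}}, max_subgroups A5 s = [set M]
                                  & M \isog 'D_10) /\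
  (* (c) *)
  (P_group A5 = (1 / 3)%R /\
   forall s, s \in A5^# -> (P_class A5 s = (1 / 3)%R <-> #[s] = 5)) /\
  (* (d) *)
  (forall g, g \in A5 ->
   exists2 x, x \in [:: dtransp 1 2 3 4; dtransp 1 3 2 4; dtransp 1 4 2 3]
            & <<[set g; x]>> \proper A5) /\
  (* (e) *)
  (spread_is A5 2 /\ uniform_spread_is A5 2 /\
   exists C, [/\ C \in classes A5, forall s, s \in C -> #[s] = 5
               & spread_ge_in A5 C 2]).
Proof.
split; first exact: min_nonid_order5 sigma_class_order5 sigma_class_gt.
split.
  move=> s As os; exists 'N_A5(<[s]>)%G.
    exact: max_subgroups_norm5 simple_A5 card_A5 _ As os.
  exact: norm5_dihedral simple_A5 card_A5 A5_inverted _ As os.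
split; first exact: min_nonid_order5 P_class_order5 P_class_gt.
split; first exact: klein_nongen.
have [s As os] := A5_order5.
have clS : s ^: A5 \in classes A5 by apply: mem_classes.
have sp2 := A5_spread2_class As os.
have sub C : C \in classes A5 -> C \subset A5.
  by case/imsetP=> x Ax ->; apply: class_subG.
split; first by split; [apply: spread_ge_inS sp2; apply: sub | apply: A5_not_spread3].
split.
  split; first by exists (s ^: A5).
  (* Uniform spread at least 3 would give spread at least 3. *)
  by case=> C /sub sCA /(spread_ge_inS sCA); apply: A5_not_spread3.
by exists (s ^: A5); split=> // _ /imsetP[x _ ->]; rewrite orderJ.
Qed.
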